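(* Let $c>\mathcal{J}^\star$ and $\tau_0<1$ be such that $\tau(\mathbf{K})\le\tau_0$ for every $\mathbf{K}\in\mathcal{G}_c\setminus\{\mathbf{K}^\star\}$. Then for every $\mathbf{K}\in\mathcal{G}_c$, $$\lVert\nabla\mathcal{J}(\mathbf{K})\rVert^2 \ge \mu\,\big(\mathcal{J}(\mathbf{K})-\mathcal{J}^\star\big),\qquad \mu=4\,(1-\tau_0)\,\underline{\lambda},$$ where $\underline{\lambda}=\lambda_{\min}(G_w)\,\lambda_{\min}(\Sigma_0)\,\lambda_{\min}(R)$.
   Context: Setting. $\{\rho_1,\dots,\rho_S\}$ is a finite grid with weights $\nu_s>0$, $\sum_{s=1}^S\nu_s=1$. $w_1,\dots,w_N$ are continuous weighting functions with $w_i(\rho)\ge 0$ and $\sum_{i=1}^N w_i(\rho)=1$; $A(\rho)=\sum_i w_i(\rho)A_i$ and $B(\rho)=\sum_i w_i(\rho)B_i$ with $A_i\in\mathbb{R}^{n\times n}$, $B_i\in\mathbb{R}^{n\times m}$. The matrices $Q,\Sigma_0\in\mathbb{R}^{n\times n}$ and $R\in\mathbb{R}^{m\times m}$ are symmetric positive definite. A gain $K\in\mathbb{R}^{m\times n}$ stabilizes plant $s$ if $A_{\mathrm{cl}}=A(\rho_s)-B(\rho_s)K$ is Schur stable (spectral radius $<1$). For such $K$: $P$ is the solution of $P=A_{\mathrm{cl}}^\top P A_{\mathrm{cl}}+Q+K^\top RK$; $\Sigma$ is the solution of $\Sigma=A_{\mathrm{cl}}\Sigma A_{\mathrm{cl}}^\top+\Sigma_0$;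 $J_s(K)=\operatorname{tr}(P\Sigma_0)$; $H=R+B(\rho_s)^\top PB(\rho_s)$; $E=HK-B(\rho_s)^\top PA(\rho_s)$. A schedule is a tuple $\mathbf{K}=(K_1,\dots,K_N)$ of matrices in $\mathbb{R}^{m\times n}$; its deployed gain at grid point $s$ is $K_{\mathbf{K}}(\rho_s)=\sum_i w_i(\rho_s)K_i$. The feasible set is the open set $\mathcal{K}=\{\mathbf{K}: K_{\mathbf{K}}(\rho_s)\text{ stabilizes plant } s,\ s=1,\dots,S\}$, and the scheduled cost is $\mathcal{J}(\mathbf{K})=\sum_s\nu_s J_s(K_{\mathbf{K}}(\rho_s))$ on $\mathcal{K}$. Write $P_s,\Sigma_s,E_s,H_s$ for the matrices $P,\Sigma,E,H$ of plant $s$ at the deployed gain $K=K_{\mathbf{K}}(\rho_s)$. The gradient $\nabla\mathcal{J}(\mathbf{K})$ has blocks $\nabla_{K_i}\mathcal{J}(\mathbf{K})=2\sum_s\nu_s w_i(\rho_s)E_s\Sigma_s$. Standing assumptions: $\mathcal{K}\ne\emptyset$ and $G_w=\sum_s\nu_s w(\rho_s)w(\rho_s)^\top\succ0$, where $w(\rho)=(w_1(\rho),\dots,w_N(\rho))^\top$. Under these, $\mathcal{J}$ attains its minimum over $\mathcal{K}$; $\mathbf{K}^\star\in\mathcal{K}$ denotes a fixed minimizer, $\mathcal{J}^\star=\mathcal{J}(\mathbf{K}^\star)$, and $\Sigma_s^\star$ is the covariance $\Sigma$ of plant $s$ at the gain $K_{\mathbf{K}^\star}(\rho_s)$. The inner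 product is $\langle X,Y\rangle=\operatorname{tr}(X^\top Y)$, summed over the tuple; $\lVert\cdot\rVert$ is the induced (Frobenius) norm; $\lambda_{\min}$ is the smallest eigenvalue of a symmetric matrix. The starred gradient $\nabla^{\star}\mathcal{J}(\mathbf{K})$ is the tuple with blocks $\nabla^{\star}_{K_i}\mathcal{J}(\mathbf{K})=2\sum_s\nu_s w_i(\rho_s)E_s\Sigma_s^\star$ (with $E_s$ evaluated at $\mathbf{K}$). With $\Delta_s=K_{\mathbf{K}}(\rho_s)-K_{\mathbf{K}^\star}(\rho_s)$, $Q_H(\mathbf{K})=\sum_s\nu_s\operatorname{tr}(\Sigma_s^\star\Delta_s^\top H_s\Delta_s)$, which is positive for $\mathbf{K}\neq\mathbf{K}^\star$. The remainder field is $\boldsymbol{\mathcal{R}}(\mathbf{K})=\tfrac12(\nabla^{\star}\mathcal{J}(\mathbf{K})-\nabla\mathcal{J}(\mathbf{K}))$, and for $\mathbf{K}\ne\mathbf{K}^\star$ the mismatch ratio is $\tau(\mathbf{K})=2\langle\boldsymbol{\mathcal{R}}(\mathbf{K}),\mathbf{K}-\mathbf{K}^\star\rangle/Q_H(\mathbf{K})$. For $c>\mathcal{J}^\star$, $\mathcal{G}_c$ is the connected component of $\{\mathbf{K}\in\mathcal{K}:\mathcal{J}(\mathbf{K})\le c\}$ containing $\mathbf{K}^\star$. *)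

(* Defs.v *)
From HB Require Import structures.
From mathcomp Require Import all_boot all_order all_algebra.
From mathcomp Require Import all_classical all_reals all_analysis.
From mathcomp Require Import complex.

Set Implicit Arguments.
Unset Strict Implicit.
Unset Printing Implicit Defensive.

Import Order.TTheory GRing.Theory Num.Theory.
Import numFieldNormedType.Exports.

Local Open Scope classical_set_scope.
Local Open Scope ring_scope.

Section MatrixNotions.
Variable R : realType.

Definition posdef k (M : 'M[R]_k) : Prop :=
  M^T = M /\ forall x : 'cV[R]_k, x != 0 -> 0 < (x^T *m M *m x) 0 0.

(* The infimum is a minimum when [M] is symmetric and [0 < k]: the set of
   real eigenvalues is then finite and nonempty. *)
Definition lambda_min k (M : 'M[R]_k) : R :=
  inf [set a | eigenvalue M a].

(* Largest modulus of a complex eigenvalue (a maximum when [0 < k]). *)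
Definition spectral_radius k (M : 'M[R]_k) : R :=
  sup [set r | exists2 z : R[i],
    eigenvalue (map_mx (real_complex R) M) z & r = complex.Re `|z|].

Definition schur_stable k (M : 'M[R]_k) : Prop := spectral_radius M < 1.

End MatrixNotions.

(* Weighted grid of plants with polytopic dependence on the parameter. The
   parameter space [T] is an arbitrary topological space. *)
Record lpv (R : realType) (T : topologicalType) (n m N S : nat) := Lpv {
  grid : 'I_S -> T ;
  nu : 'I_S -> R ;
  wt : 'I_N -> T -> R ;
  Avert : 'I_N -> 'M[R]_n ;
  Bvert : 'I_N -> 'M[R]_(n, m) ;
  Qcost : 'M[R]_n ;
  Rcost : 'M[R]_m ;
  Sigma0 : 'M[R]_n }.

Section ScheduledLQR.
Variables (R : realType) (T : topologicalType) (n m N S : nat).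
Variable p : lpv R T n m N S.

(* N-tuples of gains, with the product topology. *)
Definition schedule := {ptws 'I_N -> 'M[R]_(m, n)}.

Definition Amx (x : T) : 'M[R]_n := \sum_i wt p i x *: Avert p i.
Definition Bmx (x : T) : 'M[R]_(n, m) := \sum_i wt p i x *: Bvert p i.

Definition Gw : 'M[R]_N :=
  \sum_s nu p s *:
    ((\col_i wt p i (grid p s)) *m (\col_i wt p i (grid p s))^T).

Section SinglePlant.
Variables (s : 'I_S) (K : 'M[R]_(m, n)).

Definition As : 'M[R]_n := Amx (grid p s).
Definition Bs : 'M[R]_(n, m) := Bmx (grid p s).

Definition Acl : 'M[R]_n := As - Bs *m K.

Definition stabilizes : Prop := schur_stable Acl.

(* For a stabilizing gain each of the two Lyapunov equations has exactly one
   solution; [xget] picks it. The values at non-stabilizing gains are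
   irrelevant. *)
Definition Pmx : 'M[R]_n :=
  xget 0 [set P : 'M[R]_n |
    P = Acl^T *m P *m Acl + Qcost p + K^T *m Rcost p *m K].

Definition Sigmamx : 'M[R]_n :=
  xget 0 [set X : 'M[R]_n | X = Acl *m X *m Acl^T + Sigma0 p].

Definition plant_cost : R := \tr (Pmx *m Sigma0 p).

Definition Hmx : 'M[R]_m := Rcost p + Bs^T *m Pmx *m Bs.

Definition Emx : 'M[R]_(m, n) := Hmx *m K - Bs^T *m Pmx *m As.

End SinglePlant.

Definition deployed (K : schedule) (x : T) : 'M[R]_(m, n) :=
  \sum_i wt p i x *: K i.

Definition gain_at (K : schedule) (s : 'I_S) : 'M[R]_(m, n) :=
  deployed K (grid p s).

Definition feasible : set schedule :=
  [set K | forall s, stabilizes s (gain_at K s)].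

(* Only meaningful on [feasible]. *)
Definition cost (K : schedule) : R :=
  \sum_s nu p s * plant_cost s (gain_at K s).

Definition sched_sub (K L : schedule) : schedule := fun i => K i - L i.

Definition sched_inner (X Y : schedule) : R := \sum_i \tr ((X i)^T *m Y i).

Definition sched_norm (X : schedule) : R := Num.sqrt (sched_inner X X).

(* Gradient for the inner product above: the (a, b) entry of block i is the
   partial derivative of [cost] with respect to entry (a, b) of K_i. *)
Definition grad (K : schedule) : schedule := fun i =>
  \matrix_(a, b)
    derive (fun X : 'M[R]_(m, n) => cost (dfwith K i X)) (K i) (delta_mx a b).

Definition minimizer (Kstar : schedule) : Prop :=
  feasible Kstar /\ forall K, feasible K -> cost Kstar <= cost K.

Section Reference.
Variable Kstar : schedule.

Definition Sigma_star (s : 'I_S) : 'M[R]_n := Sigmamx s (gain_at Kstar s).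

Definition grad_star (K : schedule) : schedule := fun i =>
  2 *: \sum_s (nu p s * wt p i (grid p s)) *:
         (Emx s (gain_at K s) *m Sigma_star s).

Definition Delta (K : schedule) (s : 'I_S) : 'M[R]_(m, n) :=
  gain_at K s - gain_at Kstar s.

Definition QH (K : schedule) : R :=
  \sum_s nu p s *
    \tr (Sigma_star s *m (Delta K s)^T *m Hmx s (gain_at K s) *m Delta K s).

Definition remainder (K : schedule) : schedule := fun i =>
  2^-1 *: (grad_star K i - grad K i).

Definition mismatch (K : schedule) : R :=
  2 * sched_inner (remainder K) (sched_sub K Kstar) / QH K.

Definition sublevel_component (c : R) : set schedule :=
  connected_component [set K | feasible K /\ cost K <= c] Kstar.

End Reference.

Record standing_assumptions : Prop := StandingAssumptions {
  n_gt0 : (0 < n)%N ;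
  m_gt0 : (0 < m)%N ;
  nu_gt0 : forall s, 0 < nu p s ;
  nu_sum1 : \sum_s nu p s = 1 ;
  wt_continuous : forall i, continuous (wt p i) ;
  wt_ge0 : forall i x, 0 <= wt p i x ;
  wt_sum1 : forall x, \sum_i wt p i x = 1 ;
  Qcost_posdef : posdef (Qcost p) ;
  Rcost_posdef : posdef (Rcost p) ;
  Sigma0_posdef : posdef (Sigma0 p) ;
  feasible_nonempty : feasible !=set0 ;
  Gw_posdef : posdef Gw }.

Definition lambda_under : R :=
  lambda_min Gw * lambda_min (Sigma0 p) * lambda_min (Rcost p).

End ScheduledLQR.

(* Main.v *)
(* Put D = K - K*, h = J(K) - J*. Trace duality between the two Lyapunov
   equations gives the exact identity <grad* J(K), D> = h + Q_H(K), and
   Sigma_s* >= Sigma_0, H_s >= R give Q_H(K) >= lambda |D|^2. The remainder is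
   half the difference between grad* and the true gradient, so tau <= tau_0
   says <grad J(K), D> >= h + (1 - tau_0) Q_H(K) >= h + (1 - tau_0) lambda |D|^2;
   expanding |grad J(K) - 2 (1 - tau_0) lambda D|^2 >= 0 concludes. *)
Require Import Defs.
From HB Require Import structures.
From mathcomp Require Import all_boot all_order all_algebra.
From mathcomp Require Import all_classical all_reals all_analysis.
From mathcomp Require Import complex ring lra.

Import Order.TTheory GRing.Theory Num.Theory.
Import numFieldNormedType.Exports.

Local Open Scope classical_set_scope.
Local Open Scope ring_scope.

(** * Quadratic forms, smallest eigenvalues and trace inequalities *)

Definition quad {R : realType} {k} (M : 'M[R]_k) (x : 'cV[R]_k) : R :=
  (x^T *m M *m x) 0 0.

(** Inequalities between forms are written [psd (M - L)]; symmetry is tracked separately. *)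
Definition psd {R : realType} {k} (M : 'M[R]_k) : Prop :=
  forall x : 'cV[R]_k, 0 <= quad M x.

Section QuadraticForms.
Set Implicit Arguments.
Unset Strict Implicit.
Unset Printing Implicit Defensive.

Context {R : realType}.
Implicit Types k l : nat.

Lemma quadD k (M L : 'M[R]_k) x : quad (M + L) x = quad M x + quad L x.
Proof. by rewrite /quad mulmxDr mulmxDl mxE. Qed.

Lemma quadB k (M L : 'M[R]_k) x : quad (M - L) x = quad M x - quad L x.
Proof. by rewrite /quad mulmxBr mulmxBl !mxE. Qed.

Lemma quad_congr k l (M : 'M[R]_k) (C : 'M[R]_(k, l)) x :
  quad (C^T *m M *m C) x = quad M (C *m x).
Proof. by rewrite /quad trmx_mul !mulmxA. Qed.

Lemma quad_subZ k (M : 'M[R]_k) x y t : quad M (x - t *: y) =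
  quad M x - t * (x^T *m M *m y) 0 0 - t * (y^T *m M *m x) 0 0 +
  t ^+ 2 * quad M y.
Proof.
have xyT : (x - t *: y)^T = x^T - t *: y^T by rewrite linearB /= linearZ.
rewrite /quad xyT !(mulmxBl, mulmxBr) -!scalemxAl -!scalemxAr.
by rewrite !mxE; ring.
Qed.

Lemma quad_scalar k (a : R) (x : 'cV[R]_k) : quad a%:M x = a * quad 1%:M x.
Proof. by rewrite /quad mul_mx_scalar mulmx1 -scalemxAl mxE. Qed.

Lemma quadB_scalar k (M : 'M[R]_k) a x :
  quad (M - a%:M) x = quad M x - a * quad 1%:M x.
Proof. by rewrite quadB quad_scalar. Qed.

Lemma quad1E k (x : 'cV[R]_k) : quad 1%:M x = \sum_i x i 0 ^+ 2.
Proof. by rewrite /quad mulmx1 mxE; apply: eq_bigr => i _; rewrite mxE expr2. Qed.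

Lemma quad1_ge0 k (x : 'cV[R]_k) : 0 <= quad 1%:M x.
Proof. by rewrite quad1E sumr_ge0// => i _; rewrite sqr_ge0. Qed.

Lemma quad1_gt0 k (x : 'cV[R]_k) : x != 0 -> 0 < quad 1%:M x.
Proof.
move=> x0; rewrite lt0r quad1_ge0 andbT; apply: contra x0.
rewrite quad1E psumr_eq0; last by move=> i _; rewrite sqr_ge0.
move=> /allP x0; apply/eqP/matrixP => i j; rewrite ord1 mxE.
by have /eqP := x0 i (mem_index_enum _) => /eqP; rewrite sqrf_eq0 => /eqP.
Qed.

Lemma psdD k (M L : 'M[R]_k) : psd M -> psd L -> psd (M + L).
Proof. by move=> M0 L0 x; rewrite quadD addr_ge0. Qed.

Lemma psd_congr k l (M : 'M[R]_k) (C : 'M[R]_(k, l)) :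
  psd M -> psd (C^T *m M *m C).
Proof. by move=> M0 x; rewrite quad_congr. Qed.

Lemma posdef_psd k (M : 'M[R]_k) : posdef M -> psd M.
Proof.
move=> [_ M0] x; have [->|/M0/ltW//] := eqVneq x 0.
by rewrite /quad mulmx0 mxE.
Qed.

Lemma posdefD k (M L : 'M[R]_k) : posdef M -> L^T = L -> psd L -> posdef (M + L).
Proof.
move=> [MT M0] LT L0; split; first by rewrite linearD /= MT LT.
by move=> x /M0 xM; rewrite -/(quad _ _) quadD ltr_pwDl.
Qed.

(** Each product of two coordinates is at most the squared norm, so the sum of the moduli of the
    entries is a bound; the added 1 makes the constant invertible. *)
Lemma quad_bound k (M : 'M[R]_k) :
  exists2 C, 0 < C & forall x, quad M x <= C * quad 1%:M x.
Proof.
exists (1 + \sum_i \sum_j `|M i j|).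
  by rewrite ltr_pwDl// sumr_ge0// => i _; rewrite sumr_ge0.
move=> x.
have xle i : `|x i 0| ^+ 2 <= quad 1%:M x.
  rewrite real_normK ?num_real// quad1E (bigD1 i)//= lerDl.
  by rewrite sumr_ge0// => j _; rewrite sqr_ge0.
have : quad M x <= (\sum_i \sum_j `|M i j|) * quad 1%:M x.
  rewrite {1}/quad mxE exchange_big/= mulr_suml ler_sum// => j _.
  rewrite mxE !mulr_suml ler_sum// => i _.
  rewrite mxE (le_trans (ler_norm _))// !normrM.
  have := xle i; have := xle j; have := normr_ge0 (M i j).
  move: `|x i 0| `|x j 0| `|M i j| (quad 1%:M x) => a b c q c0 bq aq.
  have : a * b <= q by have := sqr_ge0 (a - b); rewrite sqrrB; lra.
  by move/(ler_wpM2l c0); lra.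
by have := quad1_ge0 x; lra.
Qed.

(** Eigenvectors are row vectors in the library, while [quad] takes columns: the witness is a
    transpose. *)
Lemma eigenvalue_sym k (M : 'M[R]_k) a : M^T = M -> eigenvalue M a ->
  exists2 x : 'cV[R]_k, x != 0 & quad M x = a * quad 1%:M x.
Proof.
move=> MT /eigenvalueP[v vM v0]; exists v^T; first by rewrite trmx_eq0.
by rewrite /quad trmxK vM mulmx1 -scalemxAl mxE.
Qed.

(* If the Rayleigh infimum [a] were not an eigenvalue, [M - a] would be
   invertible, hence bounded below by a positive multiple of the identity:
   evaluate it at [x - C^-1 N x] with [N] its inverse and [N <= C]. *)
Lemma posdef_min_eigenvalue k (M : 'M[R]_k) : (0 < k)%N -> posdef M ->
  exists2 a, eigenvalue M a & psd (M - a%:M).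
Proof.
move=> k0 Mpd; have [MT M0] := Mpd.
pose E := [set r | exists2 x : 'cV[R]_k, x != 0 & r = quad M x / quad 1%:M x].
have lE : has_lbound E.
  exists 0 => _ [x x0 ->]; rewrite divr_ge0 ?quad1_ge0//; exact: posdef_psd.
have E0 : E !=set0.
  exists (quad M (const_mx 1) / quad 1%:M (const_mx 1 : 'cV[R]_k)).
  exists (const_mx 1) => //; apply/eqP => /matrixP/(_ (Ordinal k0) 0).
  by rewrite !mxE => /eqP; rewrite oner_eq0.
pose a := inf E; have psdB : psd (M - a%:M).
  move=> x; have [->|x0] := eqVneq x 0; first by rewrite /quad mulmx0 mxE.
  rewrite quadB_scalar subr_ge0 -ler_pdivlMr ?quad1_gt0//.
  by apply: ge_inf => //; exists x.
exists a => //; rewrite /eigenvalue /eigenspace kermx_eq0 row_free_unit.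
apply/negP => uB; set B := M - a%:M in psdB uB; pose N := invmx B.
have [C C0 NC] := quad_bound N.
have BT : B^T = B by rewrite /B linearB /= MT tr_scalar_mx.
have NT : N^T = N by rewrite /N trmx_inv BT.
have BN : B *m N = 1%:M by rewrite mulmxV.
have Bx x : quad 1%:M x / C <= quad B x.
  have := psdB (x - C^-1 *: (N *m x)); rewrite quad_subZ.
  rewrite -(mulmxA x^T B) trmx_mul NT -(mulmxA x^T N B) (mulmxA B) BN mulVmx//.
  rewrite mul1mx -quad_congr NT mulVmx// mul1mx !mulmx1.
  have -> : (x^T *m x) 0 0 = quad 1%:M x by rewrite /quad mulmx1.
  have : C^-1 * (C^-1 * quad N x) <= C^-1 * quad 1%:M x.
    rewrite ler_pM2l ?invr_gt0// mulrC ler_pdivrMr// mulrC; exact: NC.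
  rewrite expr2 mulrA [quad 1%:M x / C]mulrC.
  move: (C^-1 * quad 1%:M x) (C^-1 * C^-1 * quad N x) (quad B x) => u v w; lra.
(* By [Bx], [a + C^-1] is a lower bound of the Rayleigh quotients, which contradicts [a] being their
   infimum. *)
suff : a + C^-1 <= a by rewrite gerDl leNgt invr_gt0 C0.
rewrite {2}/a; apply: lb_le_inf => // _ [x x0 ->].
rewrite ler_pdivlMr ?quad1_gt0// mulrDl -quad_scalar.
by have := Bx x; rewrite /B quadB; lra.
Qed.

(** The eigenvalue [a] is at least the infimum [lambda_min M], so its bound weakens to this one.
    That the spectrum is bounded below by 0 makes the infimum meaningful. *)
Lemma lambda_min_le k (M : 'M[R]_k) : (0 < k)%N -> posdef M ->
  psd (M - (lambda_min M)%:M).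
Proof.
move=> k0 Mpd; have [a Ma aM] := posdef_min_eigenvalue k0 Mpd.
move=> x; apply: (le_trans (aM x)); rewrite !quadB_scalar lerD2l lerN2.
rewrite ler_wpM2r ?quad1_ge0//; apply: ge_inf => //; exists 0 => b /=.
move=> /(eigenvalue_sym Mpd.1)[y y0 yM].
by rewrite -(pmulr_lge0 _ (quad1_gt0 y0)) -yM; exact: posdef_psd.
Qed.

(** The eigenvalue [a] is positive, and [psd (M - a%:M)] makes it a lower bound of the whole
    spectrum. *)
Lemma lambda_min_gt0 k (M : 'M[R]_k) : (0 < k)%N -> posdef M -> 0 < lambda_min M.
Proof.
move=> k0 Mpd; have [a Ma aM] := posdef_min_eigenvalue k0 Mpd.
apply: (@lt_le_trans _ _ a).
  have [x x0 xa] := eigenvalue_sym Mpd.1 Ma.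
  by rewrite -(pmulr_lgt0 _ (quad1_gt0 x0)) -xa; apply: Mpd.2.
apply: lb_le_inf; first by exists a.
move=> b /(eigenvalue_sym Mpd.1)[x x0 xb].
have := aM x; rewrite quadB_scalar xb subr_ge0.
by rewrite ler_pM2r ?quad1_gt0.
Qed.

Lemma quad_mxtrace k l (M : 'M[R]_k) (C : 'M[R]_(k, l)) :
  \tr (C^T *m M *m C) = \sum_j quad M (col j C).
Proof.
apply: eq_bigr => j _; rewrite /quad tr_col -row_mul.
by rewrite [LHS]mxE [RHS]mxE; apply: eq_bigr => i _; rewrite !mxE.
Qed.

Lemma psd_mxtrace k l (M : 'M[R]_k) (C : 'M[R]_(k, l)) :
  psd M -> 0 <= \tr (C^T *m M *m C).
Proof. by move=> M0; rewrite quad_mxtrace sumr_ge0. Qed.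

Lemma psd_mxtrace_le k l (M : 'M[R]_k) a (C : 'M[R]_(k, l)) :
  psd (M - a%:M) -> a * \tr (C^T *m C) <= \tr (C^T *m M *m C).
Proof.
move=> /psd_mxtrace -/(_ _ C); rewrite mulmxBr mulmxBl linearB /= subr_ge0.
by rewrite mul_mx_scalar -scalemxAl linearZ.
Qed.

(** Induction on the size: the Schur complement of the top-left entry is again positive definite,
    and its factor fills the lower-right block. *)
Lemma cholesky k (M : 'M[R]_k) : posdef M -> exists L : 'M[R]_k, M = L *m L^T.
Proof.
elim: k M => [|k IH] M; first by exists (0 : 'M[R]_0); apply/matrixP => -[].
rewrite -[k.+1]/(1 + k)%N in M *; move=> [MT M0].
move: MT M0; rewrite -[M]submxK.
set a := ulsubmx M; set b := ursubmx M; set b' := dlsubmx M; set C := drsubmx M.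
rewrite tr_block_mx => /eq_block_mx[_ bT _ CT] M0.
have {bT} bE : b' = b^T by rewrite -bT trmxK.
pose r := a 0 0; have aE : a = r%:M by rewrite [LHS]mx11_scalar.
have r0 : 0 < r.
  have : (col_mx 1%:M 0 : 'cV[R]_(1 + k)) != 0.
    by rewrite col_mx_eq0 negb_and oner_eq0.
  move=> /M0; rewrite tr_col_mx trmx0 trmx1 mul_row_block mul_row_col.
  by rewrite !mul1mx !mul0mx !addr0 mulmx0 addr0 mulmx1.
have [|L CL] := IH (C - r^-1 *: (b^T *m b)).
  split; first by rewrite linearB /= linearZ /= trmx_mul trmxK CT.
  (* For fixed [y], this [z] minimizes the form over the first coordinate; the minimum is the Schur
     complement at [y]. *)
  move=> y y0; pose z := - r^-1 *: (b *m y).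
  have : col_mx z y != 0 by rewrite col_mx_eq0 negb_and y0 orbT.
  move=> /M0; rewrite tr_col_mx mul_row_block mul_row_col bE aE.
  rewrite mul_mx_scalar.
  have -> : r *: z^T + y^T *m b^T = 0.
    by rewrite linearZ /= scalerA mulrN divff ?gt_eqF// scaleN1r trmx_mul addNr.
  rewrite mul0mx add0r mulmxBr.
  suff -> : z^T *m b = - (y^T *m (r^-1 *: (b^T *m b))) by rewrite addrC.
  by rewrite linearZ /= trmx_mul -!scalemxAl -scalemxAr scaleNr mulmxA.
exists (block_mx (Num.sqrt r)%:M 0 ((Num.sqrt r)^-1 *: b^T) L).
have s0 : Num.sqrt r != 0 by rewrite gt_eqF// sqrtr_gt0.
rewrite tr_block_mx mulmx_block trmx0 !mulmx0 !mul0mx !addr0.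
rewrite tr_scalar_mx -scalar_mxM -expr2 sqr_sqrtr ?ltW// linearZ /= trmxK.
rewrite mul_scalar_mx scalerA divff// scale1r mul_mx_scalar scalerA divff//.
rewrite scale1r -scalemxAl -scalemxAr scalerA -invfM -expr2 sqr_sqrtr ?ltW//.
by rewrite -CL addrC subrK aE bE.
Qed.

(** With [X = L *m L^T], cyclicity turns the trace into that of a congruence of [H], which is
    bounded by [b]; cycling back exposes a congruence of [X], bounded by [a]. *)
Lemma mxtrace_posdef_ge k l (X : 'M[R]_k) (H : 'M[R]_l) a b
    (D : 'M[R]_(l, k)) :
  posdef X -> psd (X - a%:M) -> psd (H - b%:M) -> 0 <= b ->
  a * b * \tr (D^T *m D) <= \tr (X *m D^T *m H *m D).
Proof.
move=> /cholesky[L XE] Xa Hb b0.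
have -> : \tr (X *m D^T *m H *m D) = \tr ((D *m L)^T *m H *m (D *m L)).
  by rewrite XE -!mulmxA mxtrace_mulC trmx_mul !mulmxA.
apply: le_trans (psd_mxtrace_le _ Hb).
rewrite [a * b]mulrC -mulrA ler_wpM2l// !(mxtrace_mulC _^T) trmx_mul -mulmxA.
by rewrite (mulmxA L) -XE mulmxA -{1 3}(trmxK D); exact: psd_mxtrace_le.
Qed.

End QuadraticForms.

(** * Powers of a Schur stable matrix tend to zero *)

Section StablePowers.
Set Implicit Arguments.
Unset Strict Implicit.
Unset Printing Implicit Defensive.
Context {R : realType}.
Implicit Types (k l m n : nat).
Local Notation normc := ComplexField.Normc.normc.

Lemma contraction_cvg0 (a : R) (v e : nat -> R) :
  0 <= a -> a < 1 -> (forall k, 0 <= v k) ->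
  (forall k, v k.+1 <= a * v k + e k) -> e @ \oo --> 0 -> v @ \oo --> 0.
Proof.
move=> a0 a1 v0 ve /cvgr0Pnorm_lt e_0; apply/cvgr0Pnorm_lt => eps eps0.
have a1' : 0 < 1 - a by rewrite subr_gt0.
(* With errors below [(1 - a) * (eps / 2)], the recursion has fixed point [eps / 2], so only a
   geometric term is left above it. *)
have [N _ Ne] := e_0 ((1 - a) * (eps / 2)) (mulr_gt0 a1' (divr_gt0 eps0 (ltr0Sn _ 1))).
have vN j : v (N + j)%N <= v N * a ^+ j + eps / 2.
  elim: j => [|j IH]; first by rewrite addn0 mulr1 lerDl; lra.
  rewrite addnS (le_trans (ve _))//.
  have := ltW (le_lt_trans (ler_norm _) (Ne (N + j)%N (leq_addr _ _))).
  have := ler_wpM2l a0 IH; rewrite exprS; lra.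
have /cvgr0Pnorm_lt/(_ (eps / 2)) : geometric (v N) a @ \oo --> 0.
  by apply: cvg_geometric; rewrite ger0_norm.
rewrite divr_gt0// => /(_ isT)[J _ Jv].
exists (N + J)%N => // k /= Nk; rewrite ger0_norm//.
have -> : k = (N + (k - N))%N by rewrite subnKC// (leq_trans _ Nk)// leq_addr.
apply: (le_lt_trans (vN _)).
have /Jv : (J <= k - N)%N by rewrite leq_subRL// (leq_trans _ Nk)// leq_addr.
by rewrite /= => /(le_lt_trans (ler_norm _)); lra.
Qed.

Lemma normc_shift_cvg0 (z : R[i]) (u : nat -> R[i]) : normc z < 1 ->
  (fun k => normc (u k.+1 - z * u k)) @ \oo --> 0 ->
  (fun k => normc (u k)) @ \oo --> 0.
Proof.
move=> z1; apply: contraction_cvg0 z1 _ _ => [|k|k].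
- by case: (z) => a b; rewrite sqrtr_ge0.
- by case: (u k) => a b; rewrite sqrtr_ge0.
- rewrite -ComplexField.Normc.normcM.
  by rewrite -{1}(subrKC (z * u k) (u k.+1)); exact: le_normcD.
Qed.

(** If [u k] is an entry of the k-th matrix built with the roots in [s] only, then
    [u k.+1 - z * u k] is the same entry with the factor [A - z%:M] restored. The scalar contraction
    by [z] thus removes that factor. *)
Lemma peel_roots_cvg0 n (A W : 'M[R[i]]_n.+1) (s : seq R[i]) :
  (forall z, z \in s -> normc z < 1) ->
  (forall i j, (fun k => normc
     ((A ^+ k * \prod_(z <- s) (A - z%:M) * W) i j)) @ \oo --> 0) ->
  forall i j, (fun k => normc ((A ^+ k * W) i j)) @ \oo --> 0.
Proof.
elim: s => [|z s IH] s1 AW.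
  by move=> i j; have := AW i j; under eq_fun do rewrite big_nil mulr1.
apply: IH => [y ys|i j]; first by rewrite s1// inE ys orbT.
apply: (@normc_shift_cvg0 z); first by rewrite s1// mem_head.
under eq_fun => k.
  rewrite (_ : _ - _ = (A ^+ k * \prod_(z <- z :: s) (A - z%:M) * W) i j).
    over.
  rewrite big_cons exprSr -!mulrA mulrBl mulrBr [RHS]mxE [X in _ = _ + X]mxE.
  congr (_ - _); rewrite -[z%:M * _]/(z%:M *m _) mul_scalar_mx.
  by rewrite -[A ^+ k * (_ *: _)]/(A ^+ k *m _) -scalemxAr [RHS]mxE.
exact: AW.
Qed.

(** A supremum dominates its set only if the set is bounded: the sum of the moduli of all
    characteristic roots is an upper bound. *)
Lemma eigenvalue_le_spectral_radius n (A : 'M[R]_n) (z : R[i]) :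
  eigenvalue (map_mx (real_complex R) A) z -> normc z <= spectral_radius A.
Proof.
move=> Az; apply: ub_le_sup; last by exists z.
set B := map_mx _ A in Az *.
have [r Br] := closed_field_poly_normal (char_poly B).
exists (\sum_(y <- r) normc y) => _ [y By ->].
have : y \in r.
  move: By; rewrite eigenvalue_root_char Br (monicP (char_poly_monic _)).
  by rewrite scale1r root_prod_XsubC.
move=> yr; rewrite (big_rem y)//= lerDl sumr_ge0// => -[a b] _.
by rewrite sqrtr_ge0.
Qed.

(* By Cayley-Hamilton the powers of [A] satisfy a linear recurrence whose
   characteristic roots lie in the open unit disc; the roots are removed one
   at a time. *)
Lemma schur_stable_expr_cvg0 n (A : 'M[R]_n) : schur_stable A ->
  forall i j, (fun k => (A ^+ k) i j) @ \oo --> 0.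
Proof.
case: n A => [|n] A A1; first by move=> -[].
pose B := map_mx (real_complex R) A.
have [r Br] := closed_field_poly_normal (char_poly B).
move: Br; rewrite (monicP (char_poly_monic _)) scale1r => Br.
have r1 z : z \in r -> normc z < 1.
  move=> zr; apply: le_lt_trans A1; apply: eigenvalue_le_spectral_radius.
  by rewrite eigenvalue_root_char -/B Br root_prod_XsubC.
have B0 : \prod_(z <- r) (B - z%:M) = 0.
  rewrite -[RHS](Cayley_Hamilton B) Br rmorph_prod; apply: eq_bigr => z _.
  by rewrite rmorphB /= horner_mx_X horner_mx_C.
have Bk i j : (fun k => normc ((B ^+ k * 1) i j)) @ \oo --> 0.
  apply: (peel_roots_cvg0 r1) => i' j'; rewrite B0.
  under eq_fun do rewrite mulr0 mul0r mxE ComplexField.Normc.normc0.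
  exact: cvg_cst.
move=> i j; apply/norm_cvg0P; have := Bk i j.
under eq_fun => k.
  rewrite (_ : normc _ = `|(A ^+ k) i j|); first over.
  by rewrite mulr1 -rmorphXn mxE /= expr0n /= addr0 sqrtr_sqr.
by [].
Qed.

Lemma cvg_mulmx l m n (u : nat -> 'M[R]_(l, m)) (v : nat -> 'M[R]_(m, n))
    (a : 'M[R]_(l, m)) (b : 'M[R]_(m, n)) :
  (forall i j, (fun k => u k i j) @ \oo --> a i j) ->
  (forall i j, (fun k => v k i j) @ \oo --> b i j) ->
  forall i j, (fun k => (u k *m v k) i j) @ \oo --> (a *m b) i j.
Proof.
move=> ua vb i j; rewrite mxE; under eq_fun do rewrite mxE.
apply: cvg_big; first exact: add_continuous.
by move=> h _; exact: cvgM.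
Qed.

Lemma cvg_congr_expr n (A X : 'M[R]_n) : schur_stable A ->
  forall i j, (fun k => (A ^+ k *m X *m (A ^+ k)^T) i j) @ \oo --> 0.
Proof.
move=> /schur_stable_expr_cvg0 A0 i j.
have -> : 0 = ((0 : 'M[R]_n) *m X *m 0^T) i j by rewrite !mul0mx mxE.
apply: cvg_mulmx => [|i' j'].
  apply: cvg_mulmx => i' j'; last exact: cvg_cst.
  by rewrite mxE; exact: A0.
by rewrite !mxE; under eq_fun do rewrite mxE; exact: A0.
Qed.

End StablePowers.

(** * The discrete Lyapunov equation *)

Section Lyapunov.
Set Implicit Arguments.
Unset Strict Implicit.
Unset Printing Implicit Defensive.
Context {R : realType} {n : nat}.
Implicit Types A X W : 'M[R]_n.

Lemma congr_exprS A X k : A ^+ k.+1 *m X *m (A ^+ k.+1)^T =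
  A ^+ k *m (A *m X *m A^T) *m (A ^+ k)^T.
Proof. by rewrite exprSr [(_ * _)^T]trmx_mul !mulmxA. Qed.

(** The congruences of [X] by the powers of [A] decrease as quadratic forms, start at [X] and tend
    to 0. *)
Lemma lyapunov_psd A X : schur_stable A -> psd (X - A *m X *m A^T) -> psd X.
Proof.
move=> A1 XA x; have le0 k : quad (A ^+ k *m X *m (A ^+ k)^T) x <= quad X x.
  elim: k => [|k]; first by rewrite expr0 trmx1 mulmx1 mul1mx.
  apply: le_trans; rewrite congr_exprS -subr_ge0 -quadB -mulmxBl -mulmxBr.
  by rewrite -{1}[A ^+ k]trmxK; exact: psd_congr.
apply: (@ler_cvg_to _ \oo _ R
   (fun k => quad (A ^+ k *m X *m (A ^+ k)^T) x) (fun=> quad X x)).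
- have -> : 0 = (x^T *m (0 : 'M[R]_n) *m x) 0 0 by rewrite mulmx0 mul0mx mxE.
  apply: cvg_mulmx => i j; last exact: cvg_cst.
  apply: cvg_mulmx => {}i {}j; first exact: cvg_cst.
  by rewrite mxE; exact: cvg_congr_expr.
- exact: cvg_cst.
- exact: nearW.
Qed.

(** Iterating the equation, [X] equals its congruence by every power of [A], and these tend to 0. *)
Lemma lyapunov_homogeneous A X : schur_stable A -> X = A *m X *m A^T -> X = 0.
Proof.
move=> A1 XA; have XAk k : A ^+ k *m X *m (A ^+ k)^T = X.
  elim: k => [|k IH]; first by rewrite expr0 trmx1 mulmx1 mul1mx.
  by rewrite congr_exprS -XA.
apply/matrixP => i j; rewrite mxE.
have := @cvg_congr_expr _ _ A X A1 i j.
under eq_fun do rewrite XAk.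
by apply: cvg_unique => //; exact: cvg_cst.
Qed.

Lemma lyapunov_unique A W X Y : schur_stable A ->
  X = A *m X *m A^T + W -> Y = A *m Y *m A^T + W -> X = Y.
Proof.
move=> A1 XA YA; apply/eqP; rewrite -subr_eq0; apply/eqP.
apply: (lyapunov_homogeneous A1); rewrite mulmxBr mulmxBl {1}XA {1}YA.
by rewrite opprD addrACA subrr addr0.
Qed.

(** In finite dimension injectivity gives surjectivity: [L] is the matrix of [X - A *m X *m A^T] on
    vectorized matrices, and its kernel is trivial by the homogeneous case. *)
Lemma lyapunov_exists A W : schur_stable A -> exists X, X = A *m X *m A^T + W.
Proof.
move=> A1; pose L := 1%:M - lin_mx (mulmxr A^T \o mulmx A).
have LE X : mxvec X *m L = mxvec (X - A *m X *m A^T).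
  by rewrite mulmxBr mulmx1 mul_vec_lin linearB.
have uL : L \in unitmx.
  rewrite -row_free_unit -kermx_eq0; apply/eqP/row_matrixP => i.
  rewrite row0 -[LHS]vec_mxK; apply/eqP; rewrite mxvec_eq0; apply/eqP.
  apply: (lyapunov_homogeneous A1); apply/eqP; rewrite -subr_eq0 -mxvec_eq0.
  by rewrite -LE vec_mxK -row_mul mulmx_ker row0.
exists (vec_mx (mxvec W *m invmx L)).
set X := vec_mx _; apply/eqP; rewrite addrC -subr_eq; apply/eqP/(can_inj mxvecK).
by rewrite -LE vec_mxK mulmxKV.
Qed.

(** Symmetry comes from uniqueness, since [X^T] solves the same equation. Then [X - W] is a
    congruence of the semidefinite [X], so [X] is [W] plus a semidefinite term. *)
Lemma lyapunov_posdef A W X : schur_stable A -> posdef W ->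
  X = A *m X *m A^T + W -> posdef X /\ psd (X - W).
Proof.
move=> A1 Wpd XA.
have XT : X^T = X.
  apply: (lyapunov_unique A1 _ XA).
  by rewrite [in LHS]XA linearD /= !trmx_mul trmxK Wpd.1 mulmxA.
have X0 : psd X.
  by apply: (lyapunov_psd A1); rewrite {1}XA addrAC subrr add0r; exact: posdef_psd.
have XW : psd (X - W).
  by rewrite {1}XA addrK -{1}[A]trmxK; exact: psd_congr.
split=> //; rewrite -(subrKC W X).
by apply: posdefD => //; rewrite linearB /= XT Wpd.1.
Qed.

End Lyapunov.

(** * Exact cost difference for a single plant *)

Section LQR.
Set Implicit Arguments.
Unset Strict Implicit.
Unset Printing Implicit Defensive.
Context {R : realType}.

Lemma char_poly_tr (F : comNzRingType) n (A : 'M[F]_n) :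
  char_poly A^T = char_poly A.
Proof.
rewrite /char_poly /char_poly_mx -[RHS]det_tr [in RHS]linearB /= tr_scalar_mx.
by rewrite map_trmx.
Qed.

(** The equation for [P] is a Lyapunov equation for the transposed closed loop, which has the same
    characteristic polynomial. *)
Lemma schur_stable_tr n (A : 'M[R]_n) : schur_stable A -> schur_stable A^T.
Proof.
have trE z : eigenvalue (map_mx (real_complex R) A^T) z =
    eigenvalue (map_mx (real_complex R) A) z.
  by rewrite !eigenvalue_root_char -map_trmx char_poly_tr.
suff : spectral_radius A^T = spectral_radius A by rewrite /schur_stable => ->.
rewrite /spectral_radius; apply: (congr1 sup).
apply/seteqP; split=> _ [z Az ->]; apply: (ex_intro2 _ _ z _ erefl).
  by rewrite -trE.
by rewrite trE.
Qed.

Lemma mxtraceB n (A B : 'M[R]_n) : \tr (A - B) = \tr A - \tr B.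
Proof. exact: raddfB. Qed.

(** The two Lyapunov operators are adjoint to each other for the trace pairing. *)
Lemma lyapunov_duality n (A X W M : 'M[R]_n) : X = A *m X *m A^T + W ->
  \tr (M *m W) = \tr ((M - A^T *m M *m A) *m X).
Proof.
move=> XA; have -> : W = X - A *m X *m A^T by rewrite {1}XA addrAC subrr add0r.
rewrite mulmxBr mulmxBl !mxtraceB; congr (_ - _).
by rewrite !mulmxA mxtrace_mulC !mulmxA.
Qed.

(** Duality evaluates both costs against the covariance [X] of the reference gain [L]. What remains
    is an exact quadratic expansion in [D] of the Lyapunov residual of [P] along the loop of [L]. *)
Lemma mxtrace_cost_difference n m (A Q X W P P' : 'M[R]_n) (B : 'M[R]_(n, m))
    (U : 'M[R]_m) (K L : 'M[R]_(m, n)) :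
  let D := K - L in
  let H := U + B^T *m P *m B in
  let E := H *m K - B^T *m P *m A in
  U^T = U -> P^T = P -> X^T = X ->
  P = (A - B *m K)^T *m P *m (A - B *m K) + Q + K^T *m U *m K ->
  P' = (A - B *m L)^T *m P' *m (A - B *m L) + Q + L^T *m U *m L ->
  X = (A - B *m L) *m X *m (A - B *m L)^T + W ->
  \tr (P *m W) - \tr (P' *m W) =
    2 * \tr (X *m D^T *m E) - \tr (X *m D^T *m H *m D).
Proof.
move=> D H E UT PT XT PE PE' XE; rewrite !(lyapunov_duality _ XE).
have -> : 2 * \tr (X *m D^T *m E) = \tr ((D^T *m E + E^T *m D) *m X).
  rewrite mulmxDl mxtraceD mulr_natl mulr2n; congr (_ + _).
    by rewrite -mulmxA mxtrace_mulC.
  by rewrite -mxtrace_tr !trmx_mul trmxK XT mulmxA.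
have -> : \tr (X *m D^T *m H *m D) = \tr (D^T *m H *m D *m X).
  by rewrite -!mulmxA mxtrace_mulC !mulmxA.
rewrite -!mxtraceB -!mulmxBl; congr (\tr (_ *m X)).
have -> : P' - (A - B *m L)^T *m P' *m (A - B *m L) = Q + L^T *m U *m L.
  by rewrite {1}PE' -(addrA _ Q) addrAC subrr add0r.
(* Everything is rewritten through [D] and the closed loop [F] of [K]: the loop of [L] is
   [F + B *m D], and [E] becomes [U *m K - B^T *m P *m F]. *)
have LE : L = K - D by rewrite /D opprB addrC subrK.
set F := A - B *m K in PE; have AE : A = F + B *m K by rewrite subrK.
have FE : A - B *m L = F + B *m D by rewrite LE mulmxBr AE opprB -addrA subrKC.
have EE : E = U *m K - B^T *m P *m F.
  by rewrite /E /H AE mulmxDl mulmxDr !mulmxA [X in _ - X]addrC addrKA.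
rewrite {1}PE FE {}LE {}EE; clearbody D F.
have -> : (F + B *m D)^T = F^T + D^T *m B^T by rewrite linearD /= trmx_mul.
have -> : (K - D)^T = K^T - D^T by rewrite linearB.
have -> : (U *m K - B^T *m P *m F)^T = K^T *m U - F^T *m P *m B.
  by rewrite linearB /= !trmx_mul trmxK UT PT mulmxA.
rewrite /H !(mulmxDl, mulmxDr, mulmxBl, mulmxBr, mulNmx, mulmxN) !mulmxA.
(* The noncommutative monomials become atoms, so the identity is linear and can be checked
   entrywise. *)
move: (F^T *m P *m F) (D^T *m B^T *m P *m F) (F^T *m P *m B *m D).
move: (D^T *m B^T *m P *m B *m D) (K^T *m U *m K) (D^T *m U *m K).
move: (K^T *m U *m D) (D^T *m U *m D) => a b c d e f g h.
by apply/matrixP => i j; rewrite !mxE; ring.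
Qed.

End LQR.

(** * Summation over the grid: the starred gradient and the lower bound on [QH] *)

Section ScheduledCost.
Set Implicit Arguments.
Unset Strict Implicit.
Unset Printing Implicit Defensive.
Context {R : realType} {T : topologicalType} {n m N S : nat}.
Context (p : lpv R T n m N S) (std : standing_assumptions p).
Implicit Types K L : schedule R n m N.

Lemma Sigmamx_posdef s k : stabilizes p s k ->
  posdef (Sigmamx p s k) /\ psd (Sigmamx p s k - Sigma0 p).
Proof.
move=> k1; apply: (lyapunov_posdef k1 (Sigma0_posdef std)).
exact: xgetPex (lyapunov_exists (Sigma0 p) k1).
Qed.

(** A solution exists for the transposed loop, so [xget] does not return its default 0. *)
Lemma PmxE s k : stabilizes p s k -> Pmx p s k =
  (Acl p s k)^T *m Pmx p s k *m Acl p s k + Qcost p + k^T *m Rcost p *m k.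
Proof.
move=> k1; apply: (@xgetPex _ 0 [set P | P = _]).
have [P PE] := lyapunov_exists (Qcost p + k^T *m Rcost p *m k)
  (schur_stable_tr k1).
by exists P => /=; rewrite [LHS]PE trmxK addrA.
Qed.

Lemma SigmamxE s k : stabilizes p s k -> Sigmamx p s k =
  Acl p s k *m Sigmamx p s k *m (Acl p s k)^T + Sigma0 p.
Proof. by move=> k1; exact: xgetPex (lyapunov_exists (Sigma0 p) k1). Qed.

Lemma Pmx_posdef s k : stabilizes p s k -> posdef (Pmx p s k).
Proof.
move=> k1; have [UT U0] := Rcost_posdef std.
have Wpd : posdef (Qcost p + k^T *m Rcost p *m k).
  apply: posdefD (Qcost_posdef std) _ _.
    by rewrite !trmx_mul trmxK UT mulmxA.
  by apply/psd_congr/posdef_psd/Rcost_posdef.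
apply: (lyapunov_posdef (schur_stable_tr k1) Wpd _).1.
by rewrite trmxK addrA; exact: PmxE.
Qed.

Lemma plant_cost_difference s k l : stabilizes p s k -> stabilizes p s l ->
  plant_cost p s k - plant_cost p s l =
  2 * \tr (Sigmamx p s l *m (k - l)^T *m Emx p s k) -
  \tr (Sigmamx p s l *m (k - l)^T *m Hmx p s k *m (k - l)).
Proof.
move=> k1 l1; apply: (mxtrace_cost_difference (Rcost_posdef std).1
  (Pmx_posdef k1).1 (Sigmamx_posdef l1).1.1 (PmxE k1) (PmxE l1) (SigmamxE l1)).
Qed.

Lemma DeltaE L K s : Delta p L K s =
  \sum_i wt p i (grid p s) *: sched_sub K L i.
Proof.
rewrite /Delta /gain_at /deployed -sumrB; apply: eq_bigr => i _.
by rewrite -scalerBr.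
Qed.

Lemma sched_innerE K L :
  sched_inner K L = \sum_i \sum_b \sum_a K i a b * L i a b.
Proof.
apply: eq_bigr => i _; apply: eq_bigr => b _; rewrite mxE.
by apply: eq_bigr => a _; rewrite mxE.
Qed.

(** Exchanging the sums over vertices and grid points assembles the blocks into [Delta]. Each plant
    then contributes twice its first-order term, which is its cost difference plus its share of
    [QH]. *)
Lemma grad_star_inner L K : feasible p K -> feasible p L ->
  sched_inner (grad_star p L K) (sched_sub K L) =
  cost p K - cost p L + QH p L K.
Proof.
move=> Kf Lf; rewrite /cost -sumrB -big_split /=.
transitivity (\sum_s nu p s *
  (2 * \tr (Sigma_star p L s *m (Delta p L K s)^T *m Emx p s (gain_at p K s)))).
  have trE s : \tr (Sigma_star p L s *m (Delta p L K s)^T *m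
      Emx p s (gain_at p K s)) = \sum_i wt p i (grid p s) *
      \tr ((Emx p s (gain_at p K s) *m Sigma_star p L s)^T *m sched_sub K L i).
    rewrite -mulmxA mxtrace_mulC -mulmxA -mxtrace_tr trmx_mul trmxK DeltaE.
    by rewrite mulmx_sumr raddf_sum /=; apply: eq_bigr => i _;
      rewrite -scalemxAr mxtraceZ.
  under [RHS]eq_bigr do rewrite trE !mulr_sumr.
  rewrite exchange_big /=; apply: eq_bigr => i _.
  rewrite /grad_star linearZ /= -scalemxAl mxtraceZ raddf_sum /= mulmx_suml.
  rewrite raddf_sum /= mulr_sumr; apply: eq_bigr => s _.
  by rewrite linearZ /= -scalemxAl mxtraceZ; ring.
apply: eq_bigr => s _.
by rewrite -mulrBr plant_cost_difference// -mulrDr subrK.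
Qed.

Lemma quad_Gw x :
  quad (Gw p) x = \sum_s nu p s * (\sum_i wt p i (grid p s) * x i 0) ^+ 2.
Proof.
rewrite /quad /Gw mulmx_sumr mulmx_suml summxE; apply: eq_bigr => s _.
rewrite -scalemxAr -scalemxAl mxE; congr (_ * _).
rewrite mulmxA -(mulmxA (x^T *m _)) mxE big_ord1 expr2.
by congr (_ * _); rewrite mxE; apply: eq_bigr => i _; rewrite !mxE// mulrC.
Qed.

Lemma grid_gt0 : (0 < S)%N.
Proof.
have := nu_sum1 std; case: (S) p => // q; rewrite big_ord0 => /eqP.
by rewrite eq_sym oner_eq0.
Qed.

Lemma vertices_gt0 : (0 < N)%N.
Proof.
have := wt_sum1 std (grid p (Ordinal grid_gt0)); case: (N) p => // q.
by rewrite big_ord0 => /eqP; rewrite eq_sym oner_eq0.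
Qed.

Lemma lambda_under_gt0 : 0 < lambda_under p.
Proof.
rewrite !mulr_gt0// lambda_min_gt0// ?(n_gt0 std) ?(m_gt0 std) ?vertices_gt0//.
- exact: Gw_posdef.
- exact: Sigma0_posdef.
- exact: Rcost_posdef.
Qed.

(** The estimate decouples over matrix entries: for entry [(a, b)], the weighted sum of squares over
    the grid is the form [Gw] at the vector of that entry across the vertices. *)
Lemma lambda_min_Gw_le L K :
  lambda_min (Gw p) * sched_inner (sched_sub K L) (sched_sub K L) <=
  \sum_s nu p s * \tr ((Delta p L K s)^T *m Delta p L K s).
Proof.
set D := sched_sub K L.
have -> : \sum_s nu p s * \tr ((Delta p L K s)^T *m Delta p L K s) =
    \sum_b \sum_a quad (Gw p) (\col_i D i a b).
  under [RHS]eq_bigr do under eq_bigr do rewrite quad_Gw.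
  under [RHS]eq_bigr do rewrite exchange_big /=.
  rewrite [RHS]exchange_big /=; apply: eq_bigr => s _; rewrite mulr_sumr.
  apply: eq_bigr => b _; rewrite mxE mulr_sumr; apply: eq_bigr => a _.
  rewrite mxE -expr2 DeltaE summxE; congr (_ * _ ^+ 2).
  by apply: eq_bigr => i _; rewrite !mxE.
rewrite sched_innerE exchange_big mulr_sumr ler_sum// => b _.
rewrite exchange_big mulr_sumr ler_sum// => a _.
have := lambda_min_le vertices_gt0 (Gw_posdef std) (\col_i D i a b).
rewrite quadB_scalar subr_ge0 quad1E; apply: le_trans.
by under [X in _ <= _ * X]eq_bigr do rewrite mxE expr2.
Qed.

Lemma QH_ge L K : feasible p K -> feasible p L ->
  lambda_under p * sched_inner (sched_sub K L) (sched_sub K L) <= QH p L K.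
Proof.
move=> Kf Lf; have b0 := lambda_min_gt0 (m_gt0 std) (Rcost_posdef std).
have a0 := lambda_min_gt0 (n_gt0 std) (Sigma0_posdef std).
set a := lambda_min (Sigma0 p) in a0; set b := lambda_min (Rcost p) in b0.
have -> : lambda_under p = a * b * lambda_min (Gw p).
  by rewrite /lambda_under -mulrA mulrC.
rewrite -mulrA.
apply: le_trans (ler_wpM2l (ltW (mulr_gt0 a0 b0)) (lambda_min_Gw_le L K)) _.
rewrite mulr_sumr ler_sum// => s _; rewrite mulrCA ler_wpM2l//.
  exact: ltW (nu_gt0 std s).
have [Xpd XW] := Sigmamx_posdef (Lf s).
apply: mxtrace_posdef_ge (ltW b0) => //.
  (* The covariance dominates [Sigma0], which dominates [a]; below, [Hmx] dominates [Rcost], which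
     dominates [b]. *)
  have -> : Sigma_star p L s - a%:M =
    (Sigma_star p L s - Sigma0 p) + (Sigma0 p - a%:M) by rewrite addrA subrK.
  apply: psdD => //.
  exact: lambda_min_le (n_gt0 std) (Sigma0_posdef std).
rewrite /Hmx addrAC; apply: psdD.
  exact: lambda_min_le (m_gt0 std) (Rcost_posdef std).
exact: psd_congr (posdef_psd (Pmx_posdef (Kf s))).
Qed.

Lemma sched_inner_ge0 K : 0 <= sched_inner K K.
Proof.
rewrite sched_innerE; do 3 apply: sumr_ge0 => ? _.
by rewrite -expr2 sqr_ge0.
Qed.

Lemma sched_inner_gt0 L K : K <> L ->
  0 < sched_inner (sched_sub K L) (sched_sub K L).
Proof.
move=> KL; rewrite lt0r sched_inner_ge0 andbT; apply/eqP => D0; apply: KL.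
apply/funext => i; apply/matrixP => a b; apply/eqP; rewrite -subr_eq0.
move: D0; rewrite sched_innerE => /eqP.
rewrite psumr_eq0 => [/allP/(_ i (mem_index_enum _))/=|? _]; last first.
  by do 2 apply: sumr_ge0 => ? _; rewrite -expr2 sqr_ge0.
rewrite psumr_eq0 => [/allP/(_ b (mem_index_enum _))/=|? _]; last first.
  by apply: sumr_ge0 => ? _; rewrite -expr2 sqr_ge0.
rewrite psumr_eq0 => [/allP/(_ a (mem_index_enum _))/=|? _]; last first.
  by rewrite -expr2 sqr_ge0.
by rewrite /sched_sub !mxE -expr2 sqrf_eq0.
Qed.

(** This is the nonnegative squared norm of [K - t L], expanded; the scale [t] stays free to be
    tuned later. *)
Lemma sched_inner_young t K L :
  2 * t * sched_inner K L <= sched_inner K K + t ^+ 2 * sched_inner L L.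
Proof.
rewrite !sched_innerE !mulr_sumr -big_split ler_sum// => i _ /=.
rewrite !mulr_sumr -big_split ler_sum// => b _ /=.
rewrite !mulr_sumr -big_split ler_sum// => a _ /=.
have := sqr_ge0 (K i a b - t * L i a b); rewrite !expr2; lra.
Qed.

Lemma remainder_inner L K : 2 * sched_inner (remainder p L K) (sched_sub K L) =
  sched_inner (grad_star p L K) (sched_sub K L) -
  sched_inner (grad p K) (sched_sub K L).
Proof.
rewrite /sched_inner -sumrB mulr_sumr; apply: eq_bigr => i _.
rewrite /remainder linearZ /= -scalemxAl mxtraceZ mulrA divff// mul1r.
have -> : (grad_star p L K i - grad p K i)^T =
  (grad_star p L K i)^T - (grad p K i)^T by rewrite linearB.
by rewrite mulmxBl mxtraceB.
Qed.

End ScheduledCost.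

(** * From the mismatch bound to gradient domination *)

Theorem theorem1 (R : realType) (T : topologicalType) (n m N S : nat)
    (p : lpv R T n m N S) (Kstar : schedule R n m N) (c tau0 : R) :
  standing_assumptions p ->
  minimizer p Kstar ->
  cost p Kstar < c ->
  tau0 < 1 ->
  (forall K : schedule R n m N,
      (sublevel_component p Kstar c `\ Kstar) K ->
      mismatch p Kstar K <= tau0) ->
  forall K : schedule R n m N, sublevel_component p Kstar c K ->
    4 * (1 - tau0) * lambda_under p * (cost p K - cost p Kstar)
      <= sched_norm (grad p K) ^+ 2.
Proof.
move=> std [Lf _] _ tau1 mism K Kc.
have [Kf _] : feasible p K /\ cost p K <= c := connected_component_sub Kc.
(* The mismatch bound excludes [Kstar], where the claim reduces to a square being nonnegative. *)
have [->|KL] := pselect (K = Kstar).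
  by rewrite subrr mulr0 exprn_ge0// sqrtr_ge0.
have l0 := lambda_under_gt0 std.
have d0 := sched_inner_gt0 KL.
have QH_D := QH_ge std Kf Lf.
have := mism K (conj Kc KL); rewrite /mismatch remainder_inner.
rewrite ler_pdivrMr; last by apply: lt_le_trans QH_D; rewrite mulr_gt0.
rewrite (grad_star_inner std Kf Lf) /sched_norm sqr_sqrtr ?sched_inner_ge0//.
(* With this scale [t], the terms in the squared distance cancel exactly: [t ^+ 2] equals
   [2 * t * (1 - tau0) * lambda_under p]. The factor [2 * t] left on the cost gap is the claimed
   constant. *)
have := sched_inner_young (2 * (1 - tau0) * lambda_under p) (grad p K)
  (sched_sub K Kstar).
have t0 : 0 < 1 - tau0 by rewrite subr_gt0.
set h := cost p K - cost p Kstar.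
set g := sched_inner (grad p K) (grad p K).
move: QH_D; move: (lambda_under p) l0 => l l0.
move: (sched_inner (grad p K) _) (sched_inner _ _) (QH p _ _) => gd d q.
move=> /(ler_wpM2l (ltW t0)) ldq young mis.
(* [mis] reads [h + q - gd <= tau0 * q], and [ldq] replaces [q] by [l * d]. *)
have : h + (1 - tau0) * (l * d) <= gd by lra.
have el0 : 0 <= 4 * (1 - tau0) * l by rewrite !mulr_ge0// ltW.
move=> /(ler_wpM2l el0); rewrite mulrDr -lerBrDr => /le_trans; apply.
apply: (@le_trans _ _ (2 * (2 * (1 - tau0) * l) * gd -
  (2 * (1 - tau0) * l) ^+ 2 * d)); last by rewrite lerBlDr.
by rewrite le_eqVlt; apply/orP; left; apply/eqP; ring.
Qed.
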